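(* Let $\mathbf{A}=(A_-,A_+,A)$ and $\mathbf{B}=(B_-,B_+,B)$ be invariant relations. If there exists an invariant Borel morphism from $\mathbf{A}$ to $\mathbf{B}$, then every countable Borel equivalence relation $E$ (on a standard Borel space) that is Borel non-$\mathbf{B}$ is also Borel non-$\mathbf{A}$.
   Context: A Borel equivalence relation is countable if all its classes are countable. If $E$, $F$ are equivalence relations on standard Borel spaces $X$, $Y$, a Borel homomorphism from $E$ to $F$ (written $f\colon E\to F$) is a Borel function $f\colon X\to Y$ such that $x\mathrel{E}x'$ implies $f(x)\mathrel{F}f(x')$. For a standard Borel space $Z$, $E_{\mathsf{set}}(Z)$ is the equivalence relation on $Z^\omega$ given by $\langle z_n\rangle\mathrel{E_{\mathsf{set}}(Z)}\langle z_n'\rangle$ iff $\{z_n:n\in\omega\}=\{z'_n:n\in\omega\}$. For $Z$ a subset of $2^\omega$ or $\omega^\omega$, $E_0(Z)$ is eventual equality (agreement at all but finitely many coordinates) on $Z$. A relation is a triple $\mathbf{A}=(A_-,A_+,A)$ with $A\subset A_-\times A_+$. It is invariant if each of $A_-$, $A_+$ is a Borel subset of $2^\omega$ or of $\omega^\omega$, and whenever $x\mathrel{E_0(A_-)}x'$ and $y\mathrel{E_0(A_+)}y'$ we have $x\mathrel{A}y\iff x'\mathrel{A}y'$. A countable Borel equivalence relation $E$ on $X$ is Borel non-$\mathbf{A}$ if for every Borel homomorphism $\phi\colon E\to E_{\mathsf{set}}(A_+)$ there exists a Borel homomorphism $\psi\colon E\to E_0(A_-)$ such that for all $x\in X$ and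 $n\in\omega$, $\neg(\psi(x)\mathrel{A}\phi(x)(n))$. A morphism from $\mathbf{A}$ to $\mathbf{B}$ is a pair of functions $\xi_-\colon B_-\to A_-$, $\xi_+\colon A_+\to B_+$ such that for all $b\in B_-$ and $a\in A_+$, $\xi_-(b)\mathrel{A}a$ implies $b\mathrel{B}\xi_+(a)$. It is a Borel morphism if $\xi_-$ and $\xi_+$ are Borel functions, and a Borel morphism is invariant if $\xi_-$ is a Borel homomorphism from $E_0(B_-)$ to $E_0(A_-)$. *)

(* Defs.v *)
From HB Require Import structures.
From mathcomp Require Import all_boot all_order all_algebra.
From mathcomp Require Import all_classical all_reals all_analysis.

Set Implicit Arguments.
Unset Strict Implicit.
Unset Printing Implicit Defensive.

Local Open Scope classical_set_scope.

(* Types carrying a measurable structure are pointed in the library, so the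
   spaces below are represented by measurable subsets [D] of a measurable type
   (this covers the empty space and subspaces such as A_- and A_+); a function
   D -> D' is given by a function on the ambient types mapping [D] into [D'],
   and its values outside [D] are irrelevant. *)

(* [completeType] is not used because it excludes the empty space. *)
Definition Polish (R : realType) (T : metricType R) : Prop :=
  (forall F : set_system T,
      ProperFilter F -> cauchy F -> exists l : T, F --> l) /\
  (exists2 Q : set T, countable Q & dense Q).

(* [D], with the measurable subsets of [X] contained in [D], is isomorphic to
   a Polish space with its Borel sets. *)
Definition standard_Borel (R : realType) (d : measure_display)
    (X : measurableType d) (D : set X) : Prop :=
  measurable D /\
  exists (T : metricType R) (f : T -> X),
    [/\ Polish T, set_bij [set: T] D f &
        forall B : set T, <<s open >> B <-> measurable (f @` B)].

Record countable_Borel_equivalence (d : measure_display) (X : measurableType d)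
    (D : set X) (E : set (X * X)) : Prop := {
  cber_sub : E `<=` D `*` D;
  cber_Borel : measurable E;
  cber_refl : forall x, D x -> E (x, x);
  cber_sym : forall x y, E (x, y) -> E (y, x);
  cber_trans : forall x y z, E (x, y) -> E (y, z) -> E (x, z);
  cber_countable : forall x, D x -> countable [set y | E (x, y)]
}.

Definition Borel_function (d d' : measure_display)
    (X : measurableType d) (Y : measurableType d')
    (D : set X) (D' : set Y) (f : X -> Y) : Prop :=
  set_fun D D' f /\ measurable_fun D f.

Definition Borel_homomorphism (d d' : measure_display)
    (X : measurableType d) (Y : measurableType d')
    (D : set X) (E : set (X * X)) (D' : set Y) (F : set (Y * Y))
    (f : X -> Y) : Prop :=
  Borel_function D D' f /\ forall x x', E (x, x') -> F (f x, f x').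

(* Z^omega, with the product sigma-algebra *)
Definition cylinder (d : measure_display) (T : measurableType d) :
    set (set (nat -> T)) :=
  \bigcup_n preimage_set_system setT (fun z : nat -> T => z n) measurable.

Definition omega_type (d : measure_display) (T : measurableType d) :=
  g_sigma_algebraType (@cylinder d T).

Definition omega_power (d : measure_display) (T : measurableType d)
    (Z : set T) : set (omega_type T) :=
  [set z | forall n, Z (z n)].

Definition E_set (d : measure_display) (T : measurableType d) (Z : set T) :
    set (omega_type T * omega_type T) :=
  [set z | [/\ omega_power Z z.1, omega_power Z z.2 & range z.1 = range z.2]].

(* The spaces 2^omega and omega^omega, with the Borel sets of the product of
   the discrete topologies *)
Variant alphabet := Two | Omega.

Definition symbol (a : alphabet) : ptopologicalType :=
  match a with Two => bool | Omega => nat end.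

Definition sequences (a : alphabet) : Type :=
  prod_topology (fun _ : nat => symbol a).

HB.instance Definition _ (a : alphabet) := Pointed.on (sequences a).
HB.instance Definition _ (a : alphabet) := Topological.on (sequences a).

Definition Borel_sequences (a : alphabet) :=
  g_sigma_algebraType (@open (sequences a)).

Definition E_0 (a : alphabet) (Z : set (Borel_sequences a)) :
    set (Borel_sequences a * Borel_sequences a) :=
  [set z | [/\ Z z.1, Z z.2 & \forall n \near \oo, z.1 n = z.2 n]].

Record relation (X Y : Type) := Relation {
  minus_set : set X;
  plus_set : set Y;
  graph : set (X * Y);
  graph_sub : graph `<=` minus_set `*` plus_set
}.

Definition invariant_relation (a a' : alphabet)
    (A : relation (Borel_sequences a) (Borel_sequences a')) : Prop :=
  [/\ measurable (minus_set A), measurable (plus_set A) &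
      forall x x' y y', E_0 (minus_set A) (x, x') ->
        E_0 (plus_set A) (y, y') -> (graph A (x, y) <-> graph A (x', y'))].

Definition Borel_non (a a' : alphabet)
    (A : relation (Borel_sequences a) (Borel_sequences a'))
    (d : measure_display) (X : measurableType d)
    (D : set X) (E : set (X * X)) : Prop :=
  forall phi : X -> omega_type (Borel_sequences a'),
    Borel_homomorphism D E (omega_power (plus_set A)) (E_set (plus_set A)) phi ->
  exists psi : X -> Borel_sequences a,
    Borel_homomorphism D E (minus_set A) (E_0 (minus_set A)) psi /\
    forall x n, D x -> ~ graph A (psi x, phi x n).

Definition morphism (X Y X' Y' : Type) (A : relation X Y) (B : relation X' Y')
    (xi_minus : X' -> X) (xi_plus : Y -> Y') : Prop :=
  [/\ set_fun (minus_set B) (minus_set A) xi_minus,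
      set_fun (plus_set A) (plus_set B) xi_plus &
      forall b a, minus_set B b -> plus_set A a ->
        graph A (xi_minus b, a) -> graph B (b, xi_plus a)].

Definition Borel_morphism (a a' b b' : alphabet)
    (A : relation (Borel_sequences a) (Borel_sequences a'))
    (B : relation (Borel_sequences b) (Borel_sequences b'))
    (xi_minus : Borel_sequences b -> Borel_sequences a)
    (xi_plus : Borel_sequences a' -> Borel_sequences b') : Prop :=
  [/\ morphism A B xi_minus xi_plus,
      Borel_function (minus_set B) (minus_set A) xi_minus &
      Borel_function (plus_set A) (plus_set B) xi_plus].

Definition invariant_Borel_morphism (a a' b b' : alphabet)
    (A : relation (Borel_sequences a) (Borel_sequences a'))
    (B : relation (Borel_sequences b) (Borel_sequences b'))
    (xi_minus : Borel_sequences b -> Borel_sequences a)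
    (xi_plus : Borel_sequences a' -> Borel_sequences b') : Prop :=
  Borel_morphism A B xi_minus xi_plus /\
  Borel_homomorphism (minus_set B) (E_0 (minus_set B))
    (minus_set A) (E_0 (minus_set A)) xi_minus.

(* Main.v *)
Require Import Defs.
From mathcomp Require Import all_boot all_order all_algebra.
From mathcomp Require Import all_classical all_reals all_analysis.

(** A morphism turns a challenge for [A] into a challenge for [B] and an answer
to the latter into an answer to the former.  Let [phi] be a homomorphism from
[E] to [E_set] of the plus side of [A].  Applying [xi_plus] to every term gives
a homomorphism [xi_plus^omega \o phi] into [E_set] of the plus side of [B]:
two sequences with the same range have images with the same range
([E_set_homomorphism_map]).
If [psi] answers it, then [xi_minus \o psi] answers [phi]: were
[xi_minus (psi x)] related by [A] to some [phi x n], the morphism condition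
would relate [psi x] by [B] to [xi_plus (phi x n)].  That
[xi_minus \o psi] is again a homomorphism is where the invariance of the
morphism enters ([Borel_homomorphism_comp]). *)

Local Open Scope classical_set_scope.

Lemma measurable_coordinate {d : measure_display} {T : measurableType d}
    (n : nat) :
  measurable_fun [set: omega_type T] (fun z : omega_type T => z n).
Proof.
move=> _ Y mY; apply: sub_sigma_algebra.
by exists n => //; exists Y.
Qed.

(** The cylinders generate the product sigma-algebra, so they suffice as tests:
this is the universal property of the countable power. *)
Lemma measurable_fun_omega {d d' : measure_display} {X : measurableType d}
    {T : measurableType d'} (D : set X) (f : X -> omega_type T) :
  (forall n, measurable_fun D (fun x => f x n)) -> measurable_fun D f.
Proof.
(* [measurable_fun D _] presupposes that [D] is measurable: [mD] is extracted
   from the goal first, to be fed to the coordinates [mf]. *)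
move=> mf mD; suff : measurable_fun D f by exact.
apply: (@measurability _ _ _ _ D f (@cylinder d' T)) => //.
by move=> _ [_ [n _ [Y mY <-]] <-]; rewrite setTI; exact: mf.
Qed.

Lemma Borel_function_comp {d1 d2 d3 : measure_display}
    {X : measurableType d1} {Y : measurableType d2} {Z : measurableType d3}
    {D : set X} {D' : set Y} {D'' : set Z} {g : Y -> Z} {f : X -> Y} :
  measurable D' ->
  Borel_function D' D'' g -> Borel_function D D' f ->
  Borel_function D D'' (g \o f).
Proof.
move=> mD' [gD mg] [fD mf]; split=> [x Dx|]; first exact/gD/fD.
by apply: measurable_comp mg mf => // _ [x Dx <-]; exact: fD.
Qed.

Lemma Borel_homomorphism_comp {d1 d2 d3 : measure_display}
    {X : measurableType d1} {Y : measurableType d2} {Z : measurableType d3}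
    {D : set X} {E : set (X * X)} {D' : set Y} {F : set (Y * Y)}
    {D'' : set Z} {G : set (Z * Z)} {g : Y -> Z} {f : X -> Y} :
  measurable D' ->
  Borel_homomorphism D' F D'' G g -> Borel_homomorphism D E D' F f ->
  Borel_homomorphism D E D'' G (g \o f).
Proof.
move=> mD' [Bg gF] [Bf fE]; split; first exact: Borel_function_comp Bg Bf.
by move=> x x' /fE/gF.
Qed.

Lemma measurable_omega_power {d : measure_display} {T : measurableType d}
    {Z : set T} :
  measurable Z -> measurable (omega_power Z).
Proof.
move=> mZ.
have -> : omega_power Z = \bigcap_n ((fun z : omega_type T => z n) @^-1` Z).
  by apply/seteqP; split=> z Zz n => [_|]; exact: Zz.
apply: bigcapT_measurable => n; rewrite -[X in measurable X]setTI.
exact: measurable_coordinate.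
Qed.

(** [E_set] compares ranges, and the range of [g \o z] is the image under [g]
of the range of [z]. *)
Lemma E_set_homomorphism_map {d d' : measure_display} {S : measurableType d}
    {T : measurableType d'} {Z : set S} {W : set T} {g : S -> T} :
  measurable Z -> Borel_function Z W g ->
  Borel_homomorphism (omega_power Z) (E_set Z) (omega_power W) (E_set W)
    (fun z : omega_type S => (g \o z : omega_type T)).
Proof.
move=> mZ Bg.
have gZW (z : omega_type S) : omega_power Z z -> omega_power W (g \o z).
  by move=> Zz n; exact: Bg.1.
split=> [|z z' [/= Zz Zz' zz']]; last first.
  have rg (u : nat -> S) : range (g \o u) = g @` range u.
    by rewrite image_comp.
  split; [exact: gZW|exact: gZW|].
  by rewrite /= (rg z) (rg z') zz'.
split; first exact: gZW.
apply: measurable_fun_omega => n.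
have Bn : Borel_function (omega_power Z) Z (fun z : omega_type S => z n).
  split=> [z|]; first exact.
  exact: measurable_funS (measurable_coordinate n).
exact: (Borel_function_comp mZ Bg Bn).2.
Qed.

Theorem theorem5p6 (R : realType) (a a' b b' : alphabet)
    (A : relation (Borel_sequences a) (Borel_sequences a'))
    (B : relation (Borel_sequences b) (Borel_sequences b')) :
  invariant_relation A -> invariant_relation B ->
  (exists (xi_minus : Borel_sequences b -> Borel_sequences a)
          (xi_plus : Borel_sequences a' -> Borel_sequences b'),
      invariant_Borel_morphism A B xi_minus xi_plus) ->
  forall (d : measure_display) (X : measurableType d) (D : set X)
         (E : set (X * X)),
    standard_Borel R D -> countable_Borel_equivalence D E ->
    Borel_non B D E -> Borel_non A D E.
Proof.
move=> [_ mA' _] [mB _ _] [xi_minus [xi_plus [[[_ _ xiAB] _ Bxi_plus]]]].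
move=> hom_xi_minus d X D E _ _ nonB phi hom_phi.
have [psi [hom_psi nBpsi]] := nonB _ (Borel_homomorphism_comp
  (measurable_omega_power mA') (E_set_homomorphism_map mA' Bxi_plus) hom_phi).
exists (xi_minus \o psi); split; first exact: Borel_homomorphism_comp hom_psi.
move=> x n Dx Axn; apply: (nBpsi x n Dx); apply: xiAB Axn.
- exact: hom_psi.1.1.
- exact: hom_phi.1.1.
Qed.
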